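(* Let $\overline{p}_{3,2}(n)$ be defined by $\sum_{n\ge0}\overline{p}_{3,2}(n)q^n=\prod_{n\ge1}\frac{(1+q^n)^2}{(1-q^n)^3}$. Then $\overline{p}_{3,2}(7n+5)\equiv0\pmod 7$ for all integers $n\ge0$. Moreover, writing $$\overline{C}_{3,2}(z;\tau)=\prod_{n\ge1}\frac{(1-q^n)(1+q^n)^2}{(1-\zeta q^n)(1-\zeta^{-1}q^n)(1-\zeta^2q^n)(1-\zeta^{-2}q^n)}=\sum_{n\ge0}a_n(\zeta)q^n,$$ $\overline{C}_{3,2}$ defines a crank function explaining this congruence; that is, $\overline{C}_{3,2}(0;\tau)=\sum_{n\ge0}\overline{p}_{3,2}(n)q^n$ and the cyclotomic polynomial $\Phi_7(\zeta)$ divides $a_{7n+5}(\zeta)$ in $\mathbb{Z}[\zeta,\zeta^{-1}]$ for every $n\ge0$.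
   Context: $\overline{p}_{3,2}(n)$ counts $3$-colored partitions of $n$ in which the first occurrence of any number in $2$ of the colors may be overlined. $q=e^{2\pi i\tau}$, $\zeta=e^{2\pi i z}$; each $a_n(\zeta)$ is a Laurent polynomial in $\zeta$, and $z=0$ corresponds to $\zeta=1$. $\Phi_7$ is the $7$-th cyclotomic polynomial. *)

(* Defs.v *)
From HB Require Import structures.
From mathcomp Require Import all_boot all_order all_algebra cyclotomic.
From mathcomp Require Import boolp classical_sets finmap.
From mathcomp.multinomials Require Import monalg.

Set Implicit Arguments.
Unset Strict Implicit.
Unset Printing Implicit Defensive.

Import GRing.Theory.
Local Open Scope ring_scope.

Record fps (R : comNzRingType) : predArgType := Fps { fps_coef : nat -> R }.

Notation "{ 'fps' R }" := (fps R) (at level 0, format "{ 'fps'  R }").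

(* [f n] is the coefficient of q^n in [f]. *)
Coercion fps_coef : fps >-> Funclass.

HB.instance Definition _ (R : comNzRingType) := [isNew for @fps_coef R].
HB.instance Definition _ (R : comNzRingType) := [Choice of fps R by <:].

Section FpsRing.
Variable R : comNzRingType.
Implicit Types f g h : {fps R}.

Lemma fpsP f g : (forall n, f n = g n) <-> f = g.
Proof. by split=> [fg|->//]; apply/val_inj/funext. Qed.

Definition fps_add f g : {fps R} := Fps (fun n => f n + g n).
Definition fps_opp f : {fps R} := Fps (fun n => - f n).
Definition fps_zero : {fps R} := Fps (fun=> 0).
Definition fps_one : {fps R} := Fps (fun n => (n == 0)%:R).
Definition fps_mul f g : {fps R} :=
  Fps (fun n => \sum_(j < n.+1) f j * g (n - j)%N).

Fact fps_addA : associative fps_add.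
Proof. by move=> f g h; apply/fpsP => n /=; rewrite addrA. Qed.
Fact fps_addC : commutative fps_add.
Proof. by move=> f g; apply/fpsP => n /=; rewrite addrC. Qed.
Fact fps_add0 : left_id fps_zero fps_add.
Proof. by move=> f; apply/fpsP => n /=; rewrite add0r. Qed.
Fact fps_addN : left_inverse fps_zero fps_opp fps_add.
Proof. by move=> f; apply/fpsP => n /=; rewrite addNr. Qed.

HB.instance Definition _ :=
  GRing.isZmodule.Build {fps R} fps_addA fps_addC fps_add0 fps_addN.

Let trunc n f : {poly R} := \poly_(i < n.+1) f i.

Let truncE n f i : (i <= n)%N -> (trunc n f)`_i = f i.
Proof. by move=> le_in; rewrite coef_poly ltnS le_in. Qed.

Let coef_mul (p q : {poly R}) f g n :
    (forall i, (i <= n)%N -> p`_i = f i) ->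
    (forall i, (i <= n)%N -> q`_i = g i) ->
  forall i, (i <= n)%N -> (p * q)`_i = fps_mul f g i.
Proof.
move=> pf qg i le_in; rewrite coefM; apply: eq_bigr => j _.
rewrite pf ?qg ?(leq_trans (leq_subr _ _)) //.
by rewrite (leq_trans _ le_in) // -ltnS.
Qed.

Fact fps_mulA : associative fps_mul.
Proof.
move=> f g h; apply/fpsP => n.
have T := @truncE n.
rewrite -(coef_mul (T f) (coef_mul (T g) (T h)) (leqnn n)).
by rewrite -(coef_mul (coef_mul (T f) (T g)) (T h) (leqnn n)) mulrA.
Qed.

Fact fps_mulC : commutative fps_mul.
Proof.
move=> f g; apply/fpsP => n; have T := @truncE n.
by rewrite -!(coef_mul (T _) (T _) (leqnn n)) mulrC.
Qed.

Fact fps_mul1 : left_id fps_one fps_mul.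
Proof.
move=> f; apply/fpsP => n /=; rewrite big_ord_recl /= mul1r subn0.
by rewrite big1 ?addr0 // => i _; rewrite mul0r.
Qed.

Fact fps_mulDl : left_distributive fps_mul fps_add.
Proof.
move=> f g h; apply/fpsP => n /=; rewrite -big_split /=.
by apply: eq_bigr => i _; rewrite mulrDl.
Qed.

Fact fps_one_neq0 : fps_one != 0.
Proof.
apply/eqP => /fpsP /(_ 0) /= /eqP.
by rewrite [X in _ == X]/(0 : R) oner_eq0.
Qed.

HB.instance Definition _ := GRing.Zmodule_isComNzRing.Build {fps R}
  fps_mulA fps_mulC fps_mul1 fps_mulDl fps_one_neq0.

Definition fps_unit : {pred {fps R}} := [pred f | `[< exists g, g * f = 1 >]].
Definition fps_inv f : {fps R} := xget f [set g | g * f = 1]%classic.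

Fact fps_mulV : {in fps_unit, left_inverse 1 fps_inv *%R}.
Proof.
move=> f /asboolP[g gf].
exact: (@xgetPex _ f [set g | g * f = 1]%classic (ex_intro _ g gf)).
Qed.

Fact fps_unitPl f g : g * f = 1 -> fps_unit f.
Proof. by move=> gf; apply/asboolP; exists g. Qed.

Fact fps_inv_out : {in [predC fps_unit], fps_inv =1 id}.
Proof.
move=> f /negP Uf; apply: xgetPN => g gf; apply: Uf.
exact: (fps_unitPl gf).
Qed.

HB.instance Definition _ := GRing.ComNzRing_hasMulInverse.Build {fps R}
  fps_mulV fps_unitPl fps_inv_out.

Lemma fps_coefD f g n : (f + g) n = f n + g n. Proof. by []. Qed.
Lemma fps_coefN f n : (- f) n = - f n. Proof. by []. Qed.
Lemma fps_coefB f g n : (f - g) n = f n - g n. Proof. by []. Qed.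
Lemma fps_coef0 n : (0 : {fps R}) n = 0. Proof. by []. Qed.
Lemma fps_coef1 n : (1 : {fps R}) n = (n == 0)%:R. Proof. by []. Qed.
Lemma fps_coefM f g n : (f * g) n = \sum_(j < n.+1) f j * g (n - j)%N.
Proof. by []. Qed.

Lemma fps_coef_sum I (r : seq I) (P : pred I) (F : I -> {fps R}) n :
  (\sum_(i <- r | P i) F i) n = \sum_(i <- r | P i) F i n.
Proof. by elim/big_rec2: _ => // i x y _ <-. Qed.

Lemma fps_coef_exp h k n : h 0 = 0 -> (n < k)%N -> (h ^+ k) n = 0.
Proof.
move=> h0; elim: k n => // k IHk n lt_nk; rewrite exprS fps_coefM big1 // => j _.
case: j => -[|j] /= lt_jn; first by rewrite h0 mul0r.
by rewrite IHk ?mulr0 // ltn_subLR // addSn ltnS (@leq_trans k) ?leq_addl.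
Qed.

Lemma fps_unit_coef0 f : f 0 = 1 -> f \is a GRing.unit.
Proof.
move=> f0; pose h := 1 - f.
have h0 : h 0 = 0 by rewrite fps_coefB fps_coef1 f0 subrr.
suff gf : Fps (fun n => (\sum_(k < n.+1) h ^+ k) n) * f = 1.
  exact: (fps_unitPl gf).
apply/fpsP => n; rewrite mulrC.
transitivity ((f * \sum_(k < n.+1) h ^+ k) n).
  rewrite !fps_coefM; apply: eq_bigr => -[j /= lt_jn] _; congr (_ * _).
  have le_n : ((n - j).+1 <= n.+1)%N by rewrite ltnS leq_subr.
  rewrite !fps_coef_sum (big_ord_widen _ (fun k => (h ^+ k) _) le_n).
  rewrite big_mkcond; apply: eq_bigr => k _; case: ltnP => // lt_k.
  by rewrite fps_coef_exp.
have -> : f = 1 - h by rewrite opprB addrC subrK.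
rewrite -opprB mulNr -subrX1 opprB fps_coefB fps_coef_exp ?subr0 //.
Qed.

Definition fpsC (c : R) : {fps R} := Fps (fun n => c *+ (n == 0)).
Definition fpsX : {fps R} := Fps (fun n => (n == 1)%:R).

Lemma fps_coefXn k n : (fpsX ^+ k) n = (n == k)%:R.
Proof.
elim: k n => [|k IHk] n; first by [].
rewrite exprS fps_coefM; case: n => [|n].
  by rewrite big_ord1 mul0r.
rewrite !big_ord_recl /= mul0r mul1r add0r big1 => [|j _]; last exact: mul0r.
by rewrite addr0 /bump /= subn1 IHk.
Qed.

Lemma fps_coefCM c f n : (fpsC c * f) n = c * f n.
Proof.
rewrite fps_coefM big_ord_recl /= mulr1n subn0 big1 ?addr0 // => j _.
by rewrite mulr0n mul0r.
Qed.

(* Convergence in the q-adic topology, R being discrete. *)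
Definition fps_cvg (u : nat -> {fps R}) (l : {fps R}) : Prop :=
  forall i, exists N, forall n, (N <= n)%N -> u n i = l i.

Definition fps_lim (u : nat -> {fps R}) : {fps R} :=
  xget 0 [set l | fps_cvg u l]%classic.

Lemma fps_limP u l : fps_cvg u l -> fps_lim u = l.
Proof.
move=> ul; apply: xget_unique => // m um; apply/fpsP => i.
have [N uN] := ul i; have [M uM] := um i.
by rewrite -(uN _ (leq_maxl N M)) -(uM _ (leq_maxr N M)).
Qed.

Definition fps_prod (F : nat -> {fps R}) : {fps R} :=
  fps_lim (fun N => \prod_(1 <= n < N.+1) F n).

(* [fps_one_upto k f]: f = 1 + O(q^k). *)
Definition fps_one_upto k f := forall i, (i < k)%N -> f i = (1 : {fps R}) i.

Lemma fps_one_upto_coefM k f g i :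
  fps_one_upto k g -> (i < k)%N -> (f * g) i = f i.
Proof.
move=> g1 lt_ik; rewrite -[f in RHS]mulr1 !fps_coefM; apply: eq_bigr => j _.
by rewrite g1 // (leq_ltn_trans (leq_subr _ _)).
Qed.

Lemma fps_one_uptoM k f g :
  fps_one_upto k f -> fps_one_upto k g -> fps_one_upto k (f * g).
Proof. by move=> f1 g1 i lt_ik; rewrite (fps_one_upto_coefM _ g1) ?f1. Qed.

Lemma fps_one_uptoX k f m : fps_one_upto k f -> fps_one_upto k (f ^+ m).
Proof.
by move=> f1; elim: m => // m IHm; rewrite exprS; apply: fps_one_uptoM.
Qed.

Lemma fps_one_uptoV k f :
  (0 < k)%N -> fps_one_upto k f -> fps_one_upto k f^-1.
Proof.
move=> k0 f1 i lt_ik; rewrite -(fps_one_upto_coefM _ f1 lt_ik) mulVr //.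
by apply: fps_unit_coef0; rewrite f1.
Qed.

Lemma fps_one_uptoDXn k f : fps_one_upto k (1 + f * fpsX ^+ k).
Proof.
move=> i lt_ik; rewrite fps_coefD fps_coefM big1 ?addr0 // => j _.
by rewrite fps_coefXn ltn_eqF ?mulr0 // (leq_ltn_trans (leq_subr _ _)).
Qed.

Lemma fps_prod_cvg F : (forall k, (0 < k)%N -> fps_one_upto k (F k)) ->
  fps_cvg (fun N => \prod_(1 <= n < N.+1) F n) (fps_prod F).
Proof.
move=> F1; pose u N := \prod_(1 <= n < N.+1) F n.
suff ul : fps_cvg u (Fps (fun i => u i i)) by rewrite /fps_prod (fps_limP ul).
move=> i; exists i => n /subnKC <-; elim: (n - i)%N => [|m IHm].
  by rewrite addn0.
rewrite addnS /u big_nat_recr // (fps_one_upto_coefM _ (F1 _ _)) //.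
by rewrite ltnS leq_addr.
Qed.

End FpsRing.

Definition fps_map (R S : comNzRingType) (phi : R -> S) (f : {fps R}) : {fps S} :=
  Fps (fun n => phi (f n)).

(* Z[zeta, zeta^-1] as the group ring of Z: [f@_k] is the coefficient of zeta^k in [f].  The ring
   structure of [monalg] requires a monoid without nontrivial units, which
   excludes the group int, so the product is defined here. *)
Definition laurent : predArgType := {malg int[int]}.

HB.instance Definition _ := GRing.Zmodule.on laurent.

Section LaurentRing.
Implicit Types f g h : laurent.

Definition laurent_mul f g : laurent :=
  \sum_(k <- msupp f) \sum_(l <- msupp g) << f@_k * g@_l *g k + l >>.

Let mulw (d1 d2 : {fset int}) f g : (msupp f `<=` d1)%fset ->
    (msupp g `<=` d2)%fset ->
  laurent_mul f g = \sum_(k <- d1) \sum_(l <- d2) << f@_k * g@_l *g k + l >>.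
Proof.
move=> le1 le2; rewrite /laurent_mul (big_fset_incl _ le1) /=; last first.
  move=> k _ /mcoeff_outdom fk; rewrite big1 // => l _.
  by rewrite fk mul0r monalgU0.
apply: eq_bigr => k _; apply: big_fset_incl => // l _ /mcoeff_outdom ->.
by rewrite mulr0 monalgU0.
Qed.

Fact laurent_mulC : commutative laurent_mul.
Proof.
move=> f g; rewrite /laurent_mul exchange_big; apply: eq_bigr => k _.
by apply: eq_bigr => l _; rewrite mulrC addrC.
Qed.

Fact laurent_mulDl : left_distributive laurent_mul +%R.
Proof.
move=> f g h; rewrite (mulw (msuppD_le f g) (fsubset_refl _)).
rewrite (mulw (fsubsetUl _ (msupp g)) (fsubset_refl (msupp h))).
rewrite (mulw (fsubsetUr (msupp f) _) (fsubset_refl (msupp h))).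
rewrite -big_split /=; apply: eq_bigr => k _.
rewrite -big_split /=; apply: eq_bigr => l _.
by rewrite mcoeffD mulrDl monalgUD.
Qed.

Let mulDr : right_distributive laurent_mul +%R.
Proof. by move=> f g h; rewrite ![laurent_mul f _]laurent_mulC laurent_mulDl. Qed.

Let mul0 : left_zero 0 laurent_mul.
Proof. by move=> f; rewrite /laurent_mul msupp0 big_seq_fset0. Qed.

Let mulr0_ : right_zero 0 laurent_mul.
Proof. by move=> f; rewrite laurent_mulC mul0. Qed.

Lemma laurent_mulUU (c d k l : int) :
  laurent_mul << c *g k >> << d *g l >> = << c * d *g k + l >>.
Proof.
by rewrite (mulw (@msuppU_le _ _ _ _) (@msuppU_le _ _ _ _)) !big_seq_fset1 !mcoeffUU.
Qed.

Let mul_sumr f I (r : seq I) (F : I -> laurent) :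
  laurent_mul f (\sum_(i <- r) F i) = \sum_(i <- r) laurent_mul f (F i).
Proof. exact: (big_morph _ (mulDr f) (mulr0_ f)). Qed.

Let mul_suml f I (r : seq I) (F : I -> laurent) :
  laurent_mul (\sum_(i <- r) F i) f = \sum_(i <- r) laurent_mul (F i) f.
Proof.
exact: (big_morph (laurent_mul^~ f) (fun g h => laurent_mulDl g h f) (mul0 f)).
Qed.

Fact laurent_mulA : associative laurent_mul.
Proof.
move=> f g h.
rewrite [f]monalgE (mul_suml g) (mul_suml h) (mul_suml (laurent_mul g h)).
apply: eq_bigr => k _; rewrite [g]monalgE (mul_suml h) !mul_sumr (mul_suml h).
apply: eq_bigr => l _; rewrite laurent_mulUU [h]monalgE.
rewrite (mul_sumr << g@_l *g l >>) !mul_sumr.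
apply: eq_bigr => m _.
by rewrite !laurent_mulUU mulrA addrA.
Qed.

Fact laurent_mul1 : left_id (<< 1 *g (0 : int) >> : laurent) laurent_mul.
Proof.
move=> f; rewrite [f]monalgE mul_sumr; apply: eq_bigr => k _.
by rewrite laurent_mulUU mul1r add0r.
Qed.

Fact laurent_one_neq0 : (<< 1 *g (0 : int) >> : laurent) != 0.
Proof. by rewrite monalgU_eq0. Qed.

HB.instance Definition _ := GRing.Zmodule_isComNzRing.Build laurent
  laurent_mulA laurent_mulC laurent_mul1 laurent_mulDl laurent_one_neq0.

End LaurentRing.

Definition zetaX (k : int) : laurent := << 1 *g k >>.
Notation zeta := (zetaX 1).

Lemma zetaXD k l : zetaX (k + l) = zetaX k * zetaX l.
Proof. by rewrite /zetaX [RHS]laurent_mulUU mul1r. Qed.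

Lemma zetaX0 : zetaX 0 = 1. Proof. by []. Qed.

(* A ring morphism only when [u] is a unit. *)
Definition laurent_eval (R : comUnitRingType) (u : R) (f : laurent) : R :=
  \sum_(k <- msupp f) (f@_k)%:~R * u ^ k.

Section LaurentEval.
Variables (R : comUnitRingType) (u : R).
Hypothesis u_unit : u \is a GRing.unit.

Let evalE f : laurent_eval u f = mmap (intr : int -> R) (fun k : int => u ^ k) f.
Proof. by []. Qed.

Lemma laurent_eval_zmod_morphism : zmod_morphism (laurent_eval u).
Proof. by move=> f g; rewrite !evalE raddfB. Qed.

Lemma laurent_evalU c k : laurent_eval u << c *g k >> = c%:~R * u ^ k.
Proof. by rewrite evalE mmapU. Qed.

Lemma laurent_eval_monoid_morphism : monoid_morphism (laurent_eval u).
Proof.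
split=> [|f g]; first by rewrite laurent_evalU expr0z mulr1.
rewrite [f * g]/(laurent_mul f g) /laurent_mul !evalE raddf_sum mulr_suml /=.
apply: eq_bigr => k _; rewrite raddf_sum mulr_sumr /=; apply: eq_bigr => l _.
by rewrite mmapU /= intrM exprzDr // mulrACA.
Qed.

End LaurentEval.

Definition pbar32_factor n : {fps int} :=
  let q := fpsX _ in (1 + q ^+ n) ^+ 2 / (1 - q ^+ n) ^+ 3.

Definition pbar32 : {fps int} := fps_prod pbar32_factor.

Definition Cbar32_factor n : {fps laurent} :=
  let q := fpsX _ in
  let z k := fpsC (zetaX k) in
  (1 - q ^+ n) * (1 + q ^+ n) ^+ 2 /
  ((1 - z 1 * q ^+ n) * (1 - z (-1) * q ^+ n) *
   (1 - z 2 * q ^+ n) * (1 - z (-2) * q ^+ n)).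

Definition Cbar32 : {fps laurent} := fps_prod Cbar32_factor.

Lemma fps_one_uptoBXn (R : comNzRingType) (f : {fps R}) n :
  fps_one_upto n (1 - f * fpsX R ^+ n).
Proof. by rewrite -mulNr; exact: fps_one_uptoDXn. Qed.

Lemma pbar32_cvg :
  fps_cvg (fun N => \prod_(1 <= n < N.+1) pbar32_factor n) pbar32.
Proof.
apply: fps_prod_cvg => k k_gt0; rewrite /pbar32_factor -[_ ^+ k]mul1r.
apply: fps_one_uptoM; [|apply: fps_one_uptoV => //]; apply: fps_one_uptoX.
  exact: fps_one_uptoDXn.
exact: fps_one_uptoBXn.
Qed.

Lemma Cbar32_cvg :
  fps_cvg (fun N => \prod_(1 <= n < N.+1) Cbar32_factor n) Cbar32.
Proof.
apply: fps_prod_cvg => k k_gt0; rewrite /Cbar32_factor.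
apply: fps_one_uptoM; last first.
  by apply: fps_one_uptoV => //; do !apply: fps_one_uptoM; exact: fps_one_uptoBXn.
rewrite -[fpsX _ ^+ k]mul1r; apply: fps_one_uptoM; first exact: fps_one_uptoBXn.
by apply: fps_one_uptoX; exact: fps_one_uptoDXn.
Qed.

(* Main.v *)
From HB Require Import structures.
Require Import Defs.
From mathcomp Require Import all_boot all_order all_algebra cyclotomic.
From mathcomp Require Import algC monalg ring zify.

(* At a primitive 7th root of unity z, multiplying numerator and denominator
   by (1 - q^n)(1 - z^3 q^n)(1 - z^-3 q^n) turns the crank series into
   theta(-1) theta(z^3) / prod_n (1 - q^(7n)), where
     theta(w) = prod_n (1 - q^n)(1 - w q^n)(1 - q^n / w)
              = sum_m (-1)^m (w^-m + ... + w^m) q^(m(m+1)/2)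
   by the Jacobi triple product.  If k(k+1)/2 + m(m+1)/2 = 5 mod 7 then
   (2k+1)^2 + (2m+1)^2 = 0 mod 7, so 7 divides 2m+1 and w^-m + ... + w^m
   vanishes at w = z^3.  Hence the coefficients of q^(7n+5) vanish at z, i.e.
   are divisible by Phi_7; evaluating at zeta = 1, where Phi_7(1) = 7, gives
   the congruence.  The triple product is obtained as the limit of its finite
   form, whose coefficients are the Gaussian binomials [2N+1 choose N-m]. *)

Import GRing.Theory Num.Theory.
Local Open Scope ring_scope.

(** * Ring morphisms and limits of power series *)

Section FpsConstants.
Variable R : comNzRingType.

Fact fpsC_zmod_morphism : zmod_morphism (@fpsC R).
Proof. by move=> c d; apply/fpsP => n; rewrite /= mulrnBl. Qed.

Fact fpsC_monoid_morphism : monoid_morphism (@fpsC R).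
Proof.
split; first by apply/fpsP => n.
by move=> c d; apply/fpsP => n; rewrite fps_coefCM /= mulrnAr.
Qed.

HB.instance Definition _ :=
  GRing.isZmodMorphism.Build R {fps R} (@fpsC R) fpsC_zmod_morphism.
HB.instance Definition _ :=
  GRing.isMonoidMorphism.Build R {fps R} (@fpsC R) fpsC_monoid_morphism.

End FpsConstants.

Section FpsMap.
Variables (R S : comNzRingType) (phi : {rmorphism R -> S}).

Fact fps_map_zmod_morphism : zmod_morphism (fps_map phi).
Proof. by move=> f g; apply/fpsP => n; rewrite /= rmorphB. Qed.

Fact fps_map_monoid_morphism : monoid_morphism (fps_map phi).
Proof.
split=> [|f g]; apply/fpsP => n; first by rewrite /= rmorph_nat.
by rewrite /= rmorph_sum; apply: eq_bigr => j _; rewrite rmorphM.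
Qed.

HB.instance Definition _ := GRing.isZmodMorphism.Build {fps R} {fps S}
  (fps_map phi) fps_map_zmod_morphism.
HB.instance Definition _ := GRing.isMonoidMorphism.Build {fps R} {fps S}
  (fps_map phi) fps_map_monoid_morphism.

Lemma fps_map_X : fps_map phi (fpsX R) = fpsX S.
Proof. by apply/fpsP => n; rewrite /= rmorph_nat. Qed.

Lemma fps_map_C c : fps_map phi (fpsC c) = fpsC (phi c).
Proof. by apply/fpsP => n; rewrite /= rmorphMn. Qed.

Lemma fps_cvg_map u l :
  fps_cvg u l -> fps_cvg (fun N => fps_map phi (u N)) (fps_map phi l).
Proof. by move=> ul i; have [N uN] := ul i; exists N => n /uN /= ->. Qed.

End FpsMap.

Section FpsLimits.
Variable R : comNzRingType.
Implicit Types (u v : nat -> {fps R}) (f g l : {fps R}).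

(** A common threshold for all coefficients up to i, which a Cauchy product involves together. *)
Lemma fps_cvg_upto u l i : fps_cvg u l ->
  exists N, forall n, (N <= n)%N -> forall j, (j <= i)%N -> u n j = l j.
Proof.
move=> ul; elim: i => [|i [M uM]].
  by have [N uN] := ul 0; exists N => n /uN uNn j; rewrite leqn0 => /eqP ->.
have [N uN] := ul i.+1; exists (maxn M N) => n.
rewrite geq_max => /andP[Mn Nn] j; rewrite leq_eqVlt => /predU1P[->|lt_ji].
  exact: uN.
exact: uM.
Qed.

Lemma fps_cvgM u v l m :
  fps_cvg u l -> fps_cvg v m -> fps_cvg (fun n => u n * v n) (l * m).
Proof.
move=> ul vm i; have [N uN] := fps_cvg_upto _ _ i ul.
have [M vM] := fps_cvg_upto _ _ i vm; exists (maxn N M) => n.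
rewrite geq_max => /andP[Nn Mn]; rewrite !fps_coefM; apply: eq_bigr => j _.
by rewrite uN -1?ltnS // vM // leq_subr.
Qed.

Lemma fps_cvg_unique u l m : fps_cvg u l -> fps_cvg u m -> l = m.
Proof. by move=> /fps_limP <- /fps_limP <-. Qed.

Lemma eq_fps_cvg u v l : u =1 v -> fps_cvg u l -> fps_cvg v l.
Proof. by move=> uv ul i; have [N uN] := ul i; exists N => n /uN; rewrite uv. Qed.

Lemma fps_one_upto_1BXn k n : (k <= n)%N -> fps_one_upto k (1 - fpsX R ^+ n).
Proof. by move=> /subnK <-; rewrite exprD; exact: fps_one_uptoBXn. Qed.

Lemma fps_coefXnM k (f : {fps R}) i :
  (fpsX R ^+ k * f) i = if (k <= i)%N then f (i - k)%N else 0.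
Proof.
rewrite fps_coefM; case: leqP => [le_ki|lt_ik].
  have lt_k : (k < i.+1)%N by [].
  rewrite (bigD1 (Ordinal lt_k)) //= fps_coefXn eqxx mul1r big1 ?addr0 // => j.
  by rewrite -val_eqE /= fps_coefXn => /negbTE ->; rewrite mul0r.
rewrite big1 // => j _; rewrite fps_coefXn ltn_eqF ?mul0r //.
by rewrite (leq_ltn_trans _ lt_ik) // -ltnS.
Qed.

End FpsLimits.

(** * Gaussian binomials and their recurrences *)

Section GaussianBinomials.
Variable R : comNzRingType.
Local Notation q := (fpsX R).

Definition qpoch n : {fps R} := \prod_(1 <= i < n.+1) (1 - q ^+ i).

Lemma qpoch0 : qpoch 0 = 1.
Proof. by rewrite /qpoch big_nil. Qed.

Lemma qpochS n : qpoch n.+1 = qpoch n * (1 - q ^+ n.+1).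
Proof. by rewrite /qpoch big_nat_recr. Qed.

Lemma unit_1BXn n : (0 < n)%N -> 1 - q ^+ n \is a GRing.unit.
Proof. by move=> n0; apply: fps_unit_coef0; rewrite (fps_one_upto_1BXn R 1). Qed.

Lemma unit_qpoch n : qpoch n \is a GRing.unit.
Proof.
by rewrite /qpoch big_nat rpred_prod // => i /andP[i0 _]; exact: unit_1BXn.
Qed.

(** Raises the index of an inverse, so that all terms of a recurrence share the same inverses as
    atoms for [ring]. *)
Lemma qpochVE n : (qpoch n)^-1 = (1 - q ^+ n.+1) * (qpoch n.+1)^-1.
Proof. by rewrite qpochS invrM ?unit_qpoch ?unit_1BXn // mulVKr ?unit_1BXn. Qed.

(* The Gaussian binomial coefficient [2N+1 choose N-m]. *)
Definition gauss N m : {fps R} :=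
  if (m <= N)%N then qpoch N.*2.+1 / (qpoch (N - m) * qpoch (N + m).+1) else 0.

Lemma gaussE N m x : N = (m + x)%N ->
  gauss N m = qpoch N.*2.+1 * (qpoch x)^-1 * (qpoch (N + m).+1)^-1.
Proof.
move=> ->; rewrite /gauss leq_addr addKn invrM ?unit_qpoch //; ring.
Qed.

Lemma gauss_out N m : (N < m)%N -> gauss N m = 0.
Proof. by rewrite /gauss ltnNge => /negbTE ->. Qed.

Lemma gauss_diag N : gauss N N = 1.
Proof.
by rewrite /gauss leqnn subnn qpoch0 mul1r addnn divrr ?unit_qpoch.
Qed.

(** This is the content of [triple_coef_rec] freed of signs and triangular powers of q. For m < N,
    over common inverses, it becomes a polynomial identity in q^m, q^x and q, with x = N - m - 1. *)
Lemma gauss_rec N m : (m <= N)%N ->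
  gauss N.+1 m.+1 = (1 + q ^+ N.*2.+2) * gauss N m.+1 + q ^+ (N - m) * gauss N m
                    + q ^+ (N + m).+3 * gauss N m.+2.
Proof.
rewrite leq_eqVlt => /predU1P[->|lt_mN].
  by rewrite subnn !gauss_diag !gauss_out // !mulr0 !(add0r, addr0) mulr1.
have [x defN] : exists x, N = (m.+1 + x)%N by exists (N - m.+1)%N; rewrite subnKC.
have qNm : (N - m = x.+1)%N by lia.
(* The factor 1 - q^x vanishes for x = 0, where m + 2 > N, so one formula covers the boundary
   case. *)
have -> : gauss N m.+2 = qpoch N.*2.+1 * (qpoch x.+1)^-1 *
    (qpoch (N + m).+3)^-1 * ((1 - q ^+ x) * (1 - q ^+ x.+1)).
  case: x defN {qNm} => [|x] defN.
    by rewrite gauss_out ?defN ?addn0 // subrr mul0r mulr0.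
  rewrite (@gaussE _ _ x); last by lia.
  rewrite (qpochVE x) (qpochVE x.+1) !addnS; ring.
rewrite (@gaussE N.+1 _ x.+1); last by lia.
rewrite (@gaussE N m.+1 x) // (@gaussE N m x.+1); last by lia.
rewrite (qpochVE x) !addnS !addSn (qpochVE (N + m).+1) (qpochVE (N + m).+2).
rewrite doubleS (qpochS N.*2.+2) (qpochS N.*2.+1) qNm.
have -> : q ^+ N.*2.+2 = q ^+ m * q ^+ m * q ^+ x * q ^+ x * q * q * q * q.
  by rewrite -!exprD -!exprSr; congr (_ ^+ _); lia.
have -> : q ^+ N.*2.+3 = q ^+ m * q ^+ m * q ^+ x * q ^+ x * q * q * q * q * q.
  by rewrite -!exprD -!exprSr; congr (_ ^+ _); lia.
have -> : q ^+ (N + m).+2 = q ^+ m * q ^+ m * q ^+ x * q * q * q.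
  by rewrite -!exprD -!exprSr; congr (_ ^+ _); lia.
have -> : q ^+ (N + m).+3 = q ^+ m * q ^+ m * q ^+ x * q * q * q * q.
  by rewrite -!exprD -!exprSr; congr (_ ^+ _); lia.
rewrite !exprSr; ring.
Qed.

Lemma gauss_rec0 N :
  gauss N.+1 0 = (1 + q ^+ N.*2.+2 + q ^+ N.+1) * gauss N 0
                 + q ^+ N.+2 * gauss N 1.
Proof.
(* Here the factor 1 - q^N takes care of N = 0 in the same way. *)
have -> : gauss N 1 = qpoch N.*2.+1 * (qpoch N.+1)^-1 *
    (qpoch N.+2)^-1 * ((1 - q ^+ N) * (1 - q ^+ N.+1)).
  case: N => [|N].
    by rewrite gauss_out // subrr mul0r mulr0.
  rewrite (@gaussE _ _ N); last by lia.
  rewrite (qpochVE N) (qpochVE N.+1) !addn1; ring.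
rewrite (@gaussE N.+1 _ N.+1) // (@gaussE N 0 N) // !addn0.
rewrite [X in _ = _ * (_ * X * _) + _]qpochVE (qpochVE N.+1).
rewrite doubleS (qpochS N.*2.+2) (qpochS N.*2.+1).
have -> : q ^+ N.*2.+2 = q ^+ N * q ^+ N * q * q.
  by rewrite -!exprD -!exprSr; congr (_ ^+ _); lia.
have -> : q ^+ N.*2.+3 = q ^+ N * q ^+ N * q * q * q.
  by rewrite -!exprD -!exprSr; congr (_ ^+ _); lia.
rewrite !exprSr; ring.
Qed.

Definition tri m := 'C(m.+1, 2).

Lemma triS m : tri m.+1 = (tri m + m.+1)%N.
Proof. by rewrite /tri binS bin1 addnC. Qed.

(** Coefficient of [symgeo m] in the product of (1 - w q^n)(1 - q^n / w) over 1 <= n <= N. *)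
Definition triple_coef N m : {fps R} := (-1) ^+ m * q ^+ tri m * gauss N m.

(** Effect on the coefficients of the new factor 1 + q^(2N+2) - (w + 1/w) q^(N+1), since
    multiplication by w + 1/w turns each [symgeo m.+1] into the sum of its two neighbours. *)
Lemma triple_coef_rec N m :
  triple_coef N.+1 m.+1 = (1 + q ^+ N.*2.+2) * triple_coef N m.+1
                    - q ^+ N.+1 * (triple_coef N m + triple_coef N m.+2).
Proof.
rewrite /triple_coef; case: (leqP m N) => [le_mN|lt_Nm]; last first.
  by rewrite !gauss_out ?(mulr0, addr0, subr0) //; lia.
rewrite gauss_rec // !triS.
have -> : q ^+ (N + m).+3 = q ^+ m * q ^+ m * q ^+ (N - m) * q * q * q.
  by rewrite -!exprD -!exprSr; congr (_ ^+ _); lia.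
have -> : q ^+ N.+1 = q ^+ m * q ^+ (N - m) * q.
  by rewrite -!exprD -!exprSr; congr (_ ^+ _); lia.
rewrite !exprD !exprS; ring.
Qed.

(** The minus sign inside the bracket comes from [symgeo1]: the lower neighbour of [symgeo 0] is its
    own negative. *)
Lemma triple_coef_rec0 N :
  triple_coef N.+1 0 = (1 + q ^+ N.*2.+2) * triple_coef N 0
                 - q ^+ N.+1 * (triple_coef N 1 - triple_coef N 0).
Proof.
rewrite /triple_coef gauss_rec0 (_ : tri 0 = 0)%N // (_ : tri 1 = 1)%N // !exprS; ring.
Qed.

End GaussianBinomials.

(** * Finite form of the Jacobi triple product *)

Section FiniteTripleProduct.
Variable F : fieldType.
Local Notation q := (fpsX F).
Variable w : F.
Hypotheses (w0 : w != 0) (w1 : w != 1).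

(* [w^-m + ... + w^m], in closed form (junk for [w = 1]). *)
Definition symgeo m : F := (w ^+ m.+1 - w ^- m) / (w - 1).

Lemma symgeo0 : symgeo 0 = 1.
Proof. by rewrite /symgeo expr1 expr0 invr1 divff // subr_eq0. Qed.

Lemma symgeo1 : (w + w^-1) * symgeo 0 = symgeo 1 - symgeo 0.
Proof.
by rewrite /symgeo; field; rewrite subr_eq0 w1 w0 oner_eq0.
Qed.

Lemma symgeoS m : (w + w^-1) * symgeo m.+1 = symgeo m.+2 + symgeo m.
Proof.
rewrite /symgeo !exprS; field; rewrite ?subr_eq0 ?w1 ?w0 ?expf_neq0 //.
Qed.

(** By [symgeoS] and [symgeo1], [e m] is collected at the indices m + 1 and m - 1. As [e] vanishes
    from M on, the shifted sums can run over the same range. *)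
Lemma symgeo_sum (e : nat -> {fps F}) M : (0 < M)%N ->
    (forall m, (M <= m)%N -> e m = 0) ->
  fpsC (w + w^-1) * (\sum_(m < M) fpsC (symgeo m) * e m) =
  fpsC (symgeo 0) * (e 1 - e 0) +
  \sum_(m < M) fpsC (symgeo m.+1) * (e m + e m.+2).
Proof.
case: M => // M _ e0; rewrite mulr_sumr big_ord_recl /=.
under eq_bigr do rewrite mulrA -rmorphM symgeoS rmorphD mulrDl.
rewrite big_split /= mulrA -rmorphM symgeo1 rmorphB.
under [in RHS]eq_bigr do rewrite mulrDr.
rewrite [in RHS]big_split /=.
have -> : \sum_(i < M) fpsC (symgeo i) * e (bump 0 i) =
    fpsC (symgeo 0) * e 1 + \sum_(i < M.+1) fpsC (symgeo i.+1) * e i.+2.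
  transitivity (\sum_(i < M.+2) fpsC (symgeo i) * e i.+1).
    by rewrite 2!big_ord_recr /= (e0 M.+1) ?(e0 M.+2) ?mulr0 ?addr0.
  by rewrite big_ord_recl.
rewrite (big_ord_recl _ (fun i => fpsC (symgeo (nat_of_ord i).+1) * e i)) /=.
under [in RHS]eq_bigr do rewrite /bump /=.
under [in LHS]eq_bigr do rewrite /bump /=.
ring.
Qed.

Lemma finite_triple_product N :
  \prod_(1 <= n < N.+1) ((1 - fpsC w * q ^+ n) * (1 - fpsC w^-1 * q ^+ n)) =
  \sum_(m < N.+1) fpsC (symgeo m) * triple_coef F N m.
Proof.
elim: N => [|N IHN].
  rewrite big_nil big_ord1 symgeo0 /triple_coef gauss_diag; ring.
rewrite big_nat_recr //= IHN.
have e0 m : (N.+1 <= m)%N -> triple_coef F N m = 0.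
  by move=> lt_Nm; rewrite /triple_coef gauss_out ?mulr0.
have wwV : fpsC w * fpsC w^-1 = 1 by rewrite -rmorphM mulfV ?rmorph1.
have -> : (1 - fpsC w * q ^+ N.+1) * (1 - fpsC w^-1 * q ^+ N.+1) =
    (1 + q ^+ N.*2.+2) - fpsC (w + w^-1) * q ^+ N.+1.
  rewrite (_ : q ^+ N.*2.+2 = (fpsC w * fpsC w^-1) * (q ^+ N.+1 * q ^+ N.+1)).
    rewrite rmorphD /=; ring.
  by rewrite wwV mul1r -exprD; congr (_ ^+ _); lia.
rewrite mulrBr [_ * (fpsC _ * _)]mulrC -[_ * q ^+ _ * _]mulrA.
rewrite [q ^+ N.+1 * _]mulrC mulrA (symgeo_sum _ N.+1) //.
rewrite [in RHS]big_ord_recl /= triple_coef_rec0.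
under [in RHS]eq_bigr do rewrite /bump /= add1n triple_coef_rec mulrBr.
rewrite [in RHS]sumrB.
have -> : \sum_(i < N.+1)
    fpsC (symgeo i.+1) * ((1 + q ^+ N.*2.+2) * triple_coef F N i.+1)
  = (1 + q ^+ N.*2.+2) * (\sum_(i < N.+1) fpsC (symgeo i) * triple_coef F N i
    - fpsC (symgeo 0) * triple_coef F N 0).
  (* Extending the sum to N + 1 adds a term that is zero by [e0]; the term at 0 is the one
     subtracted. *)
  transitivity ((1 + q ^+ N.*2.+2) *
      (\sum_(i < N.+2) fpsC (symgeo i) * triple_coef F N i -
       fpsC (symgeo 0) * triple_coef F N 0)).
    rewrite [in RHS]big_ord_recl [in RHS]/= addrAC subrr add0r mulr_sumr.
    by apply: eq_bigr => i _; rewrite mulrCA.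
  by rewrite big_ord_recr /= e0 // mulr0 addr0.
have -> : \sum_(i < N.+1) fpsC (symgeo i.+1) *
      (q ^+ N.+1 * (triple_coef F N i + triple_coef F N i.+2))
  = q ^+ N.+1 * \sum_(i < N.+1)
      fpsC (symgeo i.+1) * (triple_coef F N i + triple_coef F N i.+2).
  by rewrite mulr_sumr; apply: eq_bigr => i _; rewrite mulrCA.
ring.
Qed.

End FiniteTripleProduct.

(** * The infinite triple product and its exponents modulo 7 *)

Section TripleProduct.
Variable F : fieldType.
Local Notation q := (fpsX F).

Lemma qpoch_ratio k d : fps_one_upto k.+1 (qpoch F (k + d) / qpoch F k).
Proof.
elim: d => [|d IHd]; first by rewrite addn0 divrr ?unit_qpoch.
rewrite addnS qpochS mulrAC; apply: fps_one_uptoM => //.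
by apply: fps_one_upto_1BXn; rewrite ltnS leq_addr.
Qed.

(** The product regroups into two ratios as in [qpoch_ratio], with denominators of index N - m and N
    + m + 1. *)
Lemma qpochM_gauss N m : (m <= N)%N ->
  fps_one_upto (N - m).+1 (qpoch F N * gauss F N m).
Proof.
move=> le_mN; rewrite (gaussE F N m (N - m)) ?subnKC //.
rewrite -!mulrA [qpoch F N.*2.+1 * _]mulrCA [qpoch F N * _]mulrA.
apply: fps_one_uptoM.
  by have := qpoch_ratio (N - m) m; rewrite subnK.
move=> i lt_i; have -> : (N.*2.+1 = (N + m).+1 + (N - m))%N by lia.
by apply: qpoch_ratio; lia.
Qed.

Lemma leq_tri m : (m <= tri m)%N.
Proof. by elim: m => // m IHm; rewrite triS; lia. Qed.

(** The range m <= i loses no term, since m <= [tri m]. *)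
Definition theta (w : F) : {fps F} :=
  Fps (fun i => \sum_(m < i.+1) ((-1) ^+ m * symgeo F w m) *+ (i == tri m)).

Lemma triple_product (w : F) : w != 0 -> w != 1 ->
  fps_cvg (fun N => \prod_(1 <= n < N.+1)
    ((1 - q ^+ n) * ((1 - fpsC w * q ^+ n) * (1 - fpsC w^-1 * q ^+ n))))
    (theta w).
Proof.
move=> w0 w1 i; exists i => N le_iN.
rewrite (_ : \prod_(_ <= _ < _) _ = qpoch F N *
    \sum_(m < N.+1) fpsC (symgeo F w m) * triple_coef F N m); last first.
  by rewrite big_split /= (finite_triple_product _ _ w0 w1).
rewrite mulr_sumr fps_coef_sum.
transitivity (\sum_(m < N.+1) ((-1) ^+ m * symgeo F w m) *+ (i == tri m)).
  apply: eq_bigr => m _; rewrite /triple_coef.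
  rewrite (_ : qpoch F N * _ = fpsC ((-1) ^+ m * symgeo F w m) *
      (q ^+ tri m * (qpoch F N * gauss F N m))); last first.
    move: (symgeo F w m) (qpoch F N) (gauss F N m) => s P g.
    rewrite rmorphM rmorphXn rmorphN rmorph1 /=; ring.
  rewrite fps_coefCM fps_coefXnM -mulr_natr.
  congr (_ * _); case: leqP => [le_ti|lt_it]; last by rewrite ltn_eqF.
  have le_mN : (m <= N)%N by rewrite -ltnS.
  (* From i <= N and m <= [tri m] follows i - [tri m] <= N - m, within the precision of
     [qpochM_gauss]. *)
  rewrite qpochM_gauss //; last by have := leq_tri m; lia.
  by rewrite fps_coef1 subn_eq0 eqn_leq le_ti andbT.
rewrite /= (@big_ord_widen _ _ _ i.+1 N.+1
  (fun m => ((-1) ^+ m * symgeo F w m) *+ (i == tri m))) // [RHS]big_mkcond.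
apply: eq_bigr => m _; case: ltnP => // lt_im.
by rewrite ltn_eqF // (leq_trans lt_im) // leq_tri.
Qed.

(** Passing from a to a + 7 increases [tri] by 7a + 28. *)
Lemma tri_mod7 m : tri m = tri (m %% 7) %[mod 7].
Proof.
rewrite {1}(divn_eq m 7); elim: (m %/ 7)%N => [|k IHk]; first by [].
rewrite -{}IHk; set a := (k * 7 + m %% 7)%N.
have -> : (k.+1 * 7 + m %% 7 = a.+4.+3)%N by rewrite /a; lia.
rewrite !triS; lia.
Qed.

(* 8 (tri k + tri m) + 2 = (2k+1)^2 + (2m+1)^2, and -1 is not a square mod 7. *)
Lemma tri_add_mod7 k m : (tri k + tri m = 5 %[mod 7] -> m %% 7 = 3)%N.
Proof.
rewrite -modnDm (tri_mod7 k) (tri_mod7 m) modnDm => /eqP kmE; apply/eqP.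
have /allP/(_ (k %% 7)%N) : all (fun a => all (fun b =>
  (tri a + tri b == 5 %[mod 7])%N ==> (b == 3)) (iota 0 7)) (iota 0 7) by [].
rewrite mem_iota ltn_mod => /(_ isT)/allP/(_ (m %% 7)%N).
by rewrite mem_iota ltn_mod kmE => /(_ isT).
Qed.

(** Here 7 divides 2m + 1, so w^(2m+1) = 1 and the numerator w^(m+1) - w^-m vanishes. *)
Lemma symgeo_eq0 w m : w ^+ 7 = 1 -> (m %% 7 = 3)%N -> symgeo F w m = 0.
Proof.
move=> w7 m3; have w0 : w != 0.
  by apply/eqP => w0; move/eqP: w7; rewrite w0 expr0n eq_sym oner_eq0.
rewrite /symgeo; suff -> : w ^+ m.+1 = w ^- m by rewrite subrr mul0r.
apply: (mulIf (expf_neq0 m w0)); rewrite mulVf ?expf_neq0 // -exprD.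
have -> : (m.+1 + m = 7 * (m %/ 7).*2.+1)%N by lia.
by rewrite exprM w7 expr1n.
Qed.

Lemma thetaM_coef_eq0 v w n :
  w ^+ 7 = 1 -> (theta v * theta w) (7 * n + 5)%N = 0.
Proof.
move=> w7; rewrite fps_coefM big1 // => j _ /=.
rewrite mulr_suml big1 // => k _; rewrite mulr_sumr big1 // => m _.
case: eqP => [jE|_]; last by rewrite mulr0n mul0r.
case: eqP => [iE|_]; last by rewrite mulr0n mulr0.
rewrite (symgeo_eq0 w m) ?(mulr0, mul0rn) //; apply: (tri_add_mod7 k).
by rewrite -jE -iE subnKC 1?mulnC ?modnMDl // -ltnS.
Qed.

End TripleProduct.

(** * Specialization of the crank series at a unit *)

Lemma rmorph_num (A B : comNzRingType) (f : {rmorphism A -> B}) x :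
  f ((1 - x) * (1 + x) ^+ 2) = (1 - f x) * (1 + f x) ^+ 2.
Proof. by rewrite rmorphM rmorphXn rmorphB rmorphD rmorph1. Qed.

Lemma rmorph_den (A B : comNzRingType) (f : {rmorphism A -> B}) a b c d x :
  f ((1 - a * x) * (1 - b * x) * (1 - c * x) * (1 - d * x)) =
  (1 - f a * f x) * (1 - f b * f x) * (1 - f c * f x) * (1 - f d * f x).
Proof. by rewrite !rmorphM !rmorphB !rmorphM !rmorph1. Qed.

Section EvalFactor.
Variables (R : comUnitRingType) (u : R) (u_unit : u \is a GRing.unit).

(** The morphism structure depends on a proof that u is a unit, so it is packed on demand. *)
Lemma laurent_evalr : {phi : {rmorphism laurent -> R} | phi =1 laurent_eval u}.
Proof.
pose a := GRing.isZmodMorphism.Build laurent R (laurent_eval u)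
  (laurent_eval_zmod_morphism u).
pose b := GRing.isMonoidMorphism.Build laurent R (laurent_eval u)
  (laurent_eval_monoid_morphism u_unit).
pose phi : {rmorphism laurent -> R} := HB.pack (laurent_eval u) a b.
by exists phi.
Qed.

Lemma Cbar32_eval_cvg (phi : {rmorphism laurent -> R}) :
    phi =1 laurent_eval u ->
  let q := fpsX R in let z k := fpsC (u ^ k) in
  fps_cvg (fun N => \prod_(1 <= n < N.+1)
    ((1 - q ^+ n) * (1 + q ^+ n) ^+ 2 /
     ((1 - z 1 * q ^+ n) * (1 - z (-1) * q ^+ n) *
      (1 - z 2 * q ^+ n) * (1 - z (-2) * q ^+ n))))
    (fps_map phi Cbar32).
Proof.
move=> phiE q z; apply: eq_fps_cvg (fps_cvg_map _ _ phi _ _ Cbar32_cvg) => N.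
pose f : {rmorphism {fps laurent} -> {fps R}} := fps_map phi.
rewrite -[fps_map phi _]/(f _) rmorph_prod !big_nat.
apply: eq_bigr => n /andP[n0 _]; have zE k : f (fpsC (zetaX k)) = z k.
  by rewrite [LHS]fps_map_C phiE /zetaX laurent_evalU mul1r.
have xE : f (fpsX laurent ^+ n) = q ^+ n.
  by rewrite rmorphXn; congr (_ ^+ n); exact: fps_map_X.
have z1 k : fps_one_upto 1 (1 - fpsC (zetaX k) * fpsX _ ^+ n).
  by move=> i i0; rewrite fps_one_uptoBXn ?(leq_trans i0).
(* The denominator has constant coefficient 1, hence is a unit and its inverse is preserved by
   [f]. *)
rewrite /Cbar32_factor (rmorphM f) (rmorphV f); last first.
  by apply: fps_unit_coef0; do !apply: fps_one_uptoM.
by rewrite rmorph_num rmorph_den xE !zE.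
Qed.

End EvalFactor.

(** At zeta = 1 each denominator becomes (1 - q^n)^4 and one factor cancels against the numerator,
    so the partial products of both sides agree. *)
Lemma Cbar32_eval1 : fps_map (laurent_eval (1 : int)) Cbar32 = pbar32.
Proof.
have [phi phiE] := laurent_evalr _ (1 : int) (unitr1 _).
have -> : fps_map (laurent_eval (1 : int)) Cbar32 = fps_map phi Cbar32.
  by apply/fpsP => n /=; rewrite phiE.
apply: fps_cvg_unique (Cbar32_eval_cvg _ _ phi phiE) _.
apply: eq_fps_cvg pbar32_cvg => N; rewrite !big_nat; apply: eq_bigr.
move=> n /andP[n0 _]; rewrite /pbar32_factor !exp1rz !rmorph1 !mul1r.
set x := 1 - _; have ux : x \is a GRing.unit.
  apply: fps_unit_coef0; rewrite /x -[_ ^+ n]mul1r.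
  by rewrite fps_one_uptoBXn.
rewrite (_ : x * x * x * x = x * x ^+ 3); last by ring.
rewrite [(x * x ^+ 3)^-1]invrM ?unitrX //.
set a := (1 + _) ^+ 2; set b := (x ^+ 3)^-1.
rewrite -[RHS](_ : a * b * (x / x) = _); first by rewrite mulrV ?mulr1.
by move: a b (x^-1) => a b y; ring.
Qed.

(** * The polynomial Phi_7 and seventh roots of unity *)

Lemma Phi7E : 'Phi_7 = \sum_(i < 7) 'X^i :> {poly int}.
Proof.
have X1_neq0 : 'X - 1 != 0 :> {poly int} by rewrite -[1]/(1%:P) polyXsubC_eq0.
have := prod_Cyclotomic (isT : 0 < 1)%N; rewrite (_ : divisors 1 = [:: 1%N]) //.
rewrite big_seq1 expr1 => Phi1.
have := prod_Cyclotomic (isT : 0 < 7)%N; rewrite (_ : divisors 7 = [:: 1%N; 7]) //.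
rewrite big_cons big_seq1 Phi1 subrX1; exact: mulfI.
Qed.

Section SeventhRoot.
Variables (R : comNzRingType) (z : R).
Hypothesis z_sum : 1 + z + z ^+ 2 + z ^+ 3 + z ^+ 4 + z ^+ 5 + z ^+ 6 = 0.

Lemma root7_expr7 : z ^+ 7 = 1.
Proof.
apply/eqP; rewrite -subr_eq0.
have -> : z ^+ 7 - 1 =
    (z - 1) * (1 + z + z ^+ 2 + z ^+ 3 + z ^+ 4 + z ^+ 5 + z ^+ 6) by ring.
by rewrite z_sum mulr0.
Qed.

(** Conjugate factors pair up into 1 - a x + x^2, 1 - b x + x^2 and 1 - c x + x^2, where a, b, c
    have elementary symmetric functions -1, -2, 1, as the roots of t^3 + t^2 - 2t - 1. Working over
    a ring allows z to be the constant series [fpsC z] later. *)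
Lemma root7_prod x :
  (1 - z * x) * (1 - z ^+ 6 * x) * (1 - z ^+ 2 * x) * (1 - z ^+ 5 * x) *
  ((1 - x) * (1 - z ^+ 3 * x) * (1 - z ^+ 4 * x)) = 1 - x ^+ 7.
Proof.
have z7 := root7_expr7.
pose a := z + z ^+ 6; pose b := z ^+ 2 + z ^+ 5; pose c := z ^+ 3 + z ^+ 4.
have qa : (1 - z * x) * (1 - z ^+ 6 * x) = 1 - a * x + x ^+ 2.
  by rewrite /a; ring: z7.
have qb : (1 - z ^+ 2 * x) * (1 - z ^+ 5 * x) = 1 - b * x + x ^+ 2.
  by rewrite /b; ring: z7.
have qc : (1 - z ^+ 3 * x) * (1 - z ^+ 4 * x) = 1 - c * x + x ^+ 2.
  by rewrite /c; ring: z7.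
have z6 : z ^+ 6 = - (1 + z + z ^+ 2 + z ^+ 3 + z ^+ 4 + z ^+ 5).
  by apply/eqP; rewrite -addr_eq0 addrC z_sum.
have e1 : a + b + c = - 1 by rewrite /a /b /c; ring: z6.
have e2 : a * b + b * c + c * a = - 2%:R by rewrite /a /b /c; ring: z7 z6.
have e3 : a * b * c = 1 by rewrite /a /b /c; ring: z7 z6.
rewrite -[_ * (1 - z ^+ 2 * x) * _]mulrA qa qb -[(1 - x) * _ * _]mulrA qc.
transitivity ((1 - x) * ((1 + x ^+ 2) ^+ 3 - (a + b + c) * x * (1 + x ^+ 2) ^+ 2
  + (a * b + b * c + c * a) * x ^+ 2 * (1 + x ^+ 2) - a * b * c * x ^+ 3)).
  by move: a b c {e1 e2 e3 qa qb qc} => a b c; ring.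
by rewrite e1 e2 e3; ring.
Qed.

End SeventhRoot.

(** * Vanishing of crank coefficients at a primitive seventh root of unity *)

Section Vanishing.
Variable z : algC.
Hypothesis z_prim : 7.-primitive_root z.
Local Notation q := (fpsX algC).

Let z7 : z ^+ 7 = 1 := prim_expr_order z_prim.

Let z_neq0 : z != 0.
Proof. by apply/eqP => z0; move/eqP: z7; rewrite z0 expr0n eq_sym oner_eq0. Qed.

Let expz_neq1 k : (0 < k < 7)%N -> z ^+ k != 1.
Proof.
move=> k7; rewrite -[1](expr0 z) (eq_prim_root_expr z_prim) mod0n modn_small.
  by lia.
by lia.
Qed.

Lemma prim_root7_sum :
  1 + z + z ^+ 2 + z ^+ 3 + z ^+ 4 + z ^+ 5 + z ^+ 6 = 0.
Proof.
have z1 : z - 1 != 0 by rewrite subr_eq0 -[z]expr1 expz_neq1.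
apply: (mulfI z1); rewrite mulr0; transitivity (z ^+ 7 - 1); first by ring.
by rewrite z7 subrr.
Qed.

Let P7 : {fps algC} := fps_prod (fun n => 1 - q ^+ (n * 7)).

Lemma fps_prod7_cvg :
  fps_cvg (fun N => \prod_(1 <= n < N.+1) (1 - q ^+ (n * 7)))
          P7.
Proof.
by apply: fps_prod_cvg => k _; apply: fps_one_upto_1BXn; rewrite leq_pmulr.
Qed.

Lemma fps_prod7_coef0 : P7 0 = 1.
Proof.
have [N uN] := fps_prod7_cvg 0; rewrite -(uN _ (leqnn N)) big_nat.
have : fps_one_upto 1
    (\prod_(1 <= n < N.+1 | (1 <= n < N.+1)%N) (1 - q ^+ (n * 7))).
  apply: big_ind => // [|n /andP[n0 _]]; first exact: fps_one_uptoM.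
  by apply: fps_one_upto_1BXn; rewrite muln_gt0 n0.
exact.
Qed.

(** Multiplying a partial product by 1 - q^(7(N+1)) shifts exponents by multiples of 7 only. *)
Lemma fps_prod7_coef_eq0 i :
  ~~ (7 %| i)%N -> P7 i = 0.
Proof.
have [N uN] := fps_prod7_cvg i; rewrite -(uN _ (leqnn N)).
elim: N i {uN} => [|N IHN] i n7i.
  by rewrite big_nil fps_coef1; case: i n7i.
have -> : \prod_(1 <= n < N.+2) (1 - q ^+ (n * 7)) =
    \prod_(1 <= n < N.+1) (1 - q ^+ (n * 7)) -
    q ^+ (N.+1 * 7) * \prod_(1 <= n < N.+1) (1 - q ^+ (n * 7)).
  by rewrite big_nat_recr //=; ring.
rewrite fps_coefB IHN //.
rewrite fps_coefXnM; case: ifP => [le_i|_]; last by rewrite subr0.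
by rewrite IHN ?subr0 // dvdn_subl ?dvdn_mull.
Qed.

(** Compared factor by factor: [root7_prod] writes 1 - q^(7n) as the crank denominator times a
    factor of theta(z^3), using z^-3 = z^4, while the crank numerator is a factor of theta(-1). *)
Lemma Cbar32_evalM (phi : {rmorphism laurent -> algC}) :
  phi =1 laurent_eval z ->
  P7 * fps_map phi Cbar32 =
  theta algC (-1) * theta algC (z ^+ 3).
Proof.
move=> phiE.
have N1_neq1 : -1 != 1 :> algC by rewrite eq_sym -addr_eq0 (pnatr_eq0 _ 2).
have N1_neq0 : -1 != 0 :> algC by rewrite oppr_eq0 oner_eq0.
have thetaN := triple_product _ _ N1_neq0 N1_neq1.
have theta3 := triple_product _ _ (expf_neq0 3 z_neq0) (expz_neq1 3 isT).
have lhs := fps_cvgM _ _ _ _ _ fps_prod7_cvg (Cbar32_eval_cvg _ z phi phiE).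
apply: fps_cvg_unique lhs _.
apply: eq_fps_cvg (fps_cvgM _ _ _ _ _ thetaN theta3) => N.
rewrite -!big_split /= !big_nat; apply: eq_bigr => n /andP[n0 _].
have zV k l : (k + l = 7)%N -> z ^- k = z ^+ l.
  move=> kl; apply: (mulIf (expf_neq0 k z_neq0)).
  by rewrite mulVf ?expf_neq0 // -exprD addnC kl z7.
have -> : z ^ (-1) = z ^+ 6 by rewrite -(zV 1%N).
have -> : z ^ (-2) = z ^+ 5 by rewrite -(zV 2%N).
rewrite (zV 3 4)%N // expr1z -[z ^ 2]/(z ^+ 2) exprM invrN1.
rewrite !rmorphXn rmorphN rmorph1 /=.
set Z := fpsC z; set x := q ^+ n.
have Zsum : 1 + Z + Z ^+ 2 + Z ^+ 3 + Z ^+ 4 + Z ^+ 5 + Z ^+ 6 = 0.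
  rewrite -(rmorph0 (@fpsC algC)) -prim_root7_sum /Z.
  rewrite !(rmorphD (@fpsC algC)) !(rmorphXn (@fpsC algC)).
  by rewrite (rmorph1 (@fpsC algC)).
have ux : forall k, (0 < k)%N -> 1 - Z ^+ k * x \is a GRing.unit.
  move=> k k0; apply: fps_unit_coef0.
  by have := @fps_one_uptoBXn _ (Z ^+ k) n; apply.
have uD : (1 - Z * x) * (1 - Z ^+ 6 * x) * (1 - Z ^+ 2 * x) * (1 - Z ^+ 5 * x)
    \is a GRing.unit.
  by rewrite !unitrM !ux // -[Z]expr1 ux.
rewrite -(root7_prod _ _ Zsum x).
move: ((1 - Z * x) * _ * _ * _) uD => D uD.
rewrite [RHS](_ : _ = D * ((1 - x) * (1 - Z ^+ 3 * x) * (1 - Z ^+ 4 * x)) *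
  ((1 - x) * (1 + x) ^+ 2 * D^-1)) //.
rewrite [RHS](_ : _ = (D * D^-1) *
  (((1 - x) * (1 - Z ^+ 3 * x) * (1 - Z ^+ 4 * x)) * ((1 - x) * (1 + x) ^+ 2))).
  by rewrite mulrV // mul1r; ring.
by move: (D^-1) => E; ring.
Qed.

(** Strong induction on n. As [P7] has constant coefficient 1 and only exponents divisible by 7, the
    vanishing coefficient of q^(7n+5) in the product is the wanted one plus multiples of earlier
    coefficients in the same residue class. *)
Lemma Cbar32_root7_eq0 n : laurent_eval z (Cbar32 (7 * n + 5)%N) = 0.
Proof.
have z_unit : z \is a GRing.unit by rewrite unitfE.
have [phi phiE] := laurent_evalr _ z z_unit; rewrite -phiE.
rewrite -[phi _]/(fps_map phi Cbar32 (7 * n + 5)%N).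
have /fpsP PG := Cbar32_evalM phi phiE.
elim/ltn_ind: n => n IHn; have := PG (7 * n + 5)%N.
rewrite thetaM_coef_eq0; last by rewrite -exprM mulnC exprM z7 expr1n.
rewrite fps_coefM big_ord_recl fps_prod7_coef0 mul1r subn0 big1 ?addr0 //.
move=> i _; have [|/fps_prod7_coef_eq0->] := boolP (7 %| lift ord0 i)%N.
  2: by rewrite mul0r.
move=> /dvdnP[k kE]; have lt_i := ltn_ord i.
have {}kE : i.+1 = (k * 7)%N := kE.
rewrite (_ : 7 * n + 5 - lift ord0 i = 7 * (n - k) + 5)%N; last by rewrite lift0; lia.
by rewrite IHn ?mulr0 //; lia.
Qed.

End Vanishing.

(** * From vanishing at a root of unity to divisibility by Phi_7 *)

Lemma intr_laurentE c : c%:~R = << c *g (0 : int) >> :> laurent.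
Proof.
have oneE : (1 : laurent) = mkmalgU (0 : int) (1 : int) by [].
by rewrite oneE -(raddfMz (@mkmalgU _ int (0 : int))) intz.
Qed.

Lemma laurent_polyP (f : laurent) :
  exists M (p : {poly int}), zetaX (Posz M) * f = (map_poly intr p).[zeta].
Proof.
have zetaXE k : zetaX (Posz k) = zeta ^+ k.
  elim: k => // k IHk; rewrite exprS -IHk -zetaXD; congr zetaX; lia.
pose ev (p : {poly int}) : laurent := (map_poly intr p).[zeta].
have evD p r : ev (p + r) = ev p + ev r by rewrite /ev rmorphD hornerD.
have evM p r : ev (p * r) = ev p * ev r by rewrite /ev rmorphM hornerM.
have evXn k : ev 'X^k = zetaX (Posz k) by rewrite /ev map_polyXn hornerXn zetaXE.
pose P (f : laurent) := exists M (p : {poly int}), zetaX (Posz M) * f = ev p.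
rewrite -/(P f) [f]monalgE; apply: big_ind => [|g h|k _].
- by exists 0%N, 0; rewrite mulr0 /ev rmorph0 horner0.
- move=> [M [p pE]] [N [r rE]]; exists (M + N)%N, ('X^N * p + 'X^M * r).
  rewrite PoszD zetaXD evD !evM !evXn -pE -rE.
  move: (zetaX _) (zetaX _) => a b; ring.
(* Multiplication by zeta^|k| moves the monomial to exponent |k| + k >= 0; the outer absolute value
   only casts it to a natural number. *)
- exists `|k|%N, ((f@_k)%:P * 'X^(`|(Posz `|k|%N + k)%R|)).
  rewrite evM evXn /ev map_polyC hornerC /= intr_laurentE.
  rewrite [LHS]laurent_mulUU mul1r [RHS]laurent_mulUU mulr1.
  by congr (<< _ *g _ >>); lia.
Qed.

(** Division by the monic Phi_7 is exact over the integers. The remainder vanishes at z and has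
    smaller degree than the minimal polynomial of z over the rationals, whose degree is that of
    Phi_7, so it is zero. *)
Lemma Phi7_dvd (z : algC) (p : {poly int}) : 7.-primitive_root z ->
  (map_poly intr p).[z] = 0 -> exists r, p = 'Phi_7 * r.
Proof.
move=> z_prim pz0; have Phi_monic := Cyclotomic_monic 7.
exists (Pdiv.Ring.rdivp p 'Phi_7).
have defp := Pdiv.RingMonic.rdivp_eq Phi_monic p.
have lt_r := Pdiv.Ring.ltn_rmodpN0 p (monic_neq0 Phi_monic).
set r := Pdiv.Ring.rmodp p _ in defp lt_r.
suff r0 : r = 0 by rewrite {1}defp r0 addr0 mulrC.
have Phi_z : (map_poly intr 'Phi_7).[z] = 0.
  by rewrite (Cintr_Cyclotomic z_prim); apply/eqP; rewrite -rootE root_cyclotomic.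
have rz0 : (map_poly intr r).[z] = 0.
  by move: pz0; rewrite defp rmorphD rmorphM hornerD hornerM Phi_z mulr0 add0r.
have [m [mE m_monic] mP] := minCpolyP z.
have pQC (s : {poly int}) :
    map_poly ratr (map_poly intr s : {poly rat}) = map_poly intr s :> {poly algC}.
  by rewrite -map_poly_comp; apply: eq_map_poly => c /=; rewrite ratr_int.
have dvd_r : (m %| map_poly intr r)%R by rewrite -mP rootE pQC rz0.
apply/eqP; apply: contraTT dvd_r => r_neq0; apply/negP => /dvdp_leq.
have inj : injective (intr : int -> rat) := @intr_inj rat.
rewrite map_poly_eq0_id0 ?(intr_eq0) ?lead_coef_eq0 // => /(_ r_neq0).
rewrite size_map_inj_poly // leqNgt => /negP; apply.
rewrite -(size_map_poly (ratr : rat -> algC) m) -mE (minCpoly_cyclotomic z_prim).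
by rewrite -(Cintr_Cyclotomic z_prim) size_map_inj_poly //; exact: intr_inj.
Qed.

Lemma Cbar32_Phi7_dvd n : exists b : laurent,
  Cbar32 (7 * n + 5)%N = (map_poly intr 'Phi_7).[zeta] * b.
Proof.
have [z z_prim] := C_prim_root_exists (isT : 0 < 7)%N.
have z_neq0 : z != 0 by rewrite (prim_root_eq0 z_prim).
have z_unit : z \is a GRing.unit by rewrite unitfE.
have [phi phiE] := laurent_evalr _ z z_unit.
have [M [p pE]] := laurent_polyP (Cbar32 (7 * n + 5)%N).
have phi_zeta : phi zeta = z by rewrite phiE laurent_evalU mul1r expr1z.
have phi_intr (r : {poly int}) :
    phi (map_poly intr r).[zeta] = (map_poly intr r).[z].
  rewrite -horner_map phi_zeta -map_poly_comp; congr _.[_].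
  by apply: eq_map_poly => c /=; rewrite rmorph_int.
have [r pr] : exists r, p = 'Phi_7 * r.
  apply: (Phi7_dvd z) => //.
  by rewrite -phi_intr -pE rmorphM [phi (Cbar32 _)]phiE Cbar32_root7_eq0 ?mulr0.
(* The factor zeta^-M undoes the shift by which [laurent_polyP] cleared the negative exponents. *)
exists (zetaX (- Posz M) * (map_poly intr r).[zeta]).
by rewrite mulrCA -hornerM -rmorphM -pr -pE mulrA -zetaXD addNr zetaX0 mul1r.
Qed.

Theorem theorem1p4 :
  [/\ forall n : nat, (pbar32 (7 * n + 5)%N = 0 %[mod 7])%Z,
      fps_map (laurent_eval (1 : int)) Cbar32 = pbar32
    & forall n : nat, exists b : laurent,
        Cbar32 (7 * n + 5)%N = (map_poly intr 'Phi_7).[zeta] * b].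
Proof.
split; [move=> n | exact: Cbar32_eval1 | exact: Cbar32_Phi7_dvd].
rewrite -Cbar32_eval1 /=; have [b ->] := Cbar32_Phi7_dvd n.
have [phi phiE] := laurent_evalr _ (1 : int) (unitr1 _).
have phi_zeta : phi zeta = 1 by rewrite phiE laurent_evalU mul1r expr1z.
rewrite -phiE rmorphM -horner_map phi_zeta.
have -> : (map_poly phi (map_poly intr 'Phi_7)).[1] = 7%:R.
  rewrite -map_poly_comp (eq_map_poly (g := intr)) => [|c /=].
    2: by rewrite rmorph_int.
  rewrite map_poly_id => [|c _]; last exact: intz.
  by rewrite Phi7E horner_sum !big_ord_recr big_ord0 /= !hornerXn !expr1n.
by rewrite mulrC modzMl mod0z.
Qed.
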